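(* Let $d\ge 1$, let $\mathbf P\in\mathbb C^{d\times d}$ be a unitary matrix, and let $\alpha_1,\ldots,\alpha_d\in\mathbb R$. For $s\in\mathbb Z$ define $$\mathbf W_s=\mathbf P^{\mathsf H}\mathbf\Lambda^{(s)}\mathbf P,\qquad \mathbf\Lambda^{(s)}=\mathrm{diag}\{\exp(i s\alpha_1),\ldots,\exp(i s\alpha_d)\}.$$ Then $\mathbf W_{t-s}=\mathbf W_s^{\mathsf H}\mathbf W_t$ for all $s,t\in\mathbb Z$.
   Context: $\mathsf H$ denotes conjugate transposition and $i$ is the imaginary unit. *)

(* Defs.v *)
From HB Require Import structures.
From mathcomp Require Import all_boot all_order all_algebra.
From mathcomp Require Import all_classical all_reals.
From mathcomp Require Import topology normedtype sequences.
From mathcomp Require Import complex.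

Set Implicit Arguments.
Unset Strict Implicit.
Unset Printing Implicit Defensive.

Import Order.TTheory GRing.Theory Num.Theory.
Import numFieldNormedType.Exports.

Local Open Scope classical_set_scope.
Local Open Scope ring_scope.
Local Open Scope complex_scope.
Local Open Scope sesquilinear_scope.

(* The complex exponential, as the sum of its power series, in analogy with
   expR; the ascription to R[i]^o selects the topology of the modulus. *)
Definition cexp (R : realType) (z : R[i]) : R[i] :=
  limn (series (fun n => z ^+ n / n`!%:R : R[i]^o)).

Definition Lam (R : realType) (d : nat) (alpha : 'I_d -> R) (s : int) :
    'M[R[i]]_d :=
  diag_mx (\row_j cexp ('i%C * s%:~R * (alpha j)%:C)).

Definition Wmx (R : realType) (d : nat) (P : 'M[R[i]]_d) (alpha : 'I_d -> R)
    (s : int) : 'M[R[i]]_d :=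
  P^t* *m Lam alpha s *m P.

(* Main.v *)
(* On the imaginary axis the partial sums of [cexp] split into those of [cos] and
   [sin], so cexp (i x) = cos x + i sin x; the subtraction formulas of [cos] and
   [sin] then give Lam (t - s) = (Lam s)^H Lam t, and P P^H = 1 does the rest. *)
Require Import Defs.
From mathcomp Require Import all_boot all_order all_algebra.
From mathcomp Require Import all_reals complex.
From mathcomp Require Import boolp classical_sets filter topology normedtype.
From mathcomp Require Import sequences trigo.

Import Order.TTheory GRing.Theory Num.Theory.
Import numFieldNormedType.Exports.
Local Open Scope ring_scope.
Local Open Scope sesquilinear_scope.

(** The embedding of the reals is an isometry for the modulus, and a positive [e] in [R[i]] is real,
    so the real [epsilon] can be taken to be its real part. *)
Lemma cvg_real_complex (R : realType) (u : nat -> R) (a : R) :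
  (u @ \oo --> a)%classic ->
  ((fun n => (u n)%:C%C : R[i]^o) @ \oo --> (a%:C%C : R[i]^o))%classic.
Proof.
move=> /cvgrPdist_lt ua; apply/cvgrPdist_lt => e e0.
have eE : e = (complex.Re e)%:C%C by rewrite RRe_real ?gtr0_real.
have re0 : 0 < complex.Re e by rewrite -ltcR -eE.
have := ua _ re0; apply: filterS => n /= un.
rewrite -rmorphB normc_def /= expr0n addr0 sqrtr_sqr.
by rewrite eE ltcR.
Qed.

Lemma expi_coeff (R : realType) (x : R) (n : nat) :
  ('i * x%:C)%C ^+ n / n`!%:R = (cos_coeff x n)%:C%C + 'i%C * (sin_coeff x n)%:C%C.
Proof.
(* Powers of ['i] by parity, in the shape of [cos_coeff] and [sin_coeff]; at [n = 0] the truncated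
   [n.-1] is harmless, its factor [odd n] being zero. *)
have iE : 'i%C ^+ n = ((~~ odd n)%:R * (-1) ^+ n./2)%:C%C
    + 'i%C * ((odd n)%:R * (-1) ^+ n.-1./2)%:C%C :> R[i].
  rewrite -{1}(odd_double_half n) exprD -mul2n exprM sqr_i.
  have := odd_double_half n; case: (odd n) => /= [<-|_].
    rewrite /= doubleK expr1 !rmorphM !rmorphXn !rmorphN1 rmorph1 rmorph0.
    by rewrite mul0r add0r mul1r add0n uphalf_double.
  by rewrite !rmorphM !rmorphXn !rmorphN1 rmorph1 rmorph0 mul0r mulr0 addr0.
rewrite exprMn iE /cos_coeff /sin_coeff /=.
have -> : n`!%:R = (n`!%:R : R)%:C%C by rewrite rmorph_nat.
by rewrite !rmorphM !fmorphV !rmorphXn /= -!mulrA mulrDl -!mulrA.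
Qed.

Lemma cexpi (R : realType) (x : R) : cexp ('i * x%:C)%C = (cos x +i* sin x)%C.
Proof.
have cosl : (series (cos_coeff x) @ \oo --> cos x)%classic.
  by rewrite unlock; exact: is_cvg_series_cos_coeff.
have sinl : (series (sin_coeff x) @ \oo --> sin x)%classic.
  by rewrite unlock; exact: is_cvg_series_sin_coeff.
rewrite [RHS]complexE /= /cexp; apply: (@cvg_lim R[i]^o); first exact: norm_hausdorff.
(* The factor ['i] is written as a scaling so that its continuity on the normed module [R[i]^o]
   applies. *)
rewrite (_ : series _ = (fun n => (series (cos_coeff x) n)%:C%C : R[i]^o) \+
  (fun n => 'i%C *: ((series (sin_coeff x) n)%:C%C : R[i]^o))); last first.
  apply/funext => n /=; rewrite /series /= !rmorph_sum /= scaler_sumr -big_split.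
  by apply: eq_bigr => k _; rewrite expi_coeff.
apply: cvgD; first exact: cvg_real_complex.
by apply: cvgZl_tmp; exact: cvg_real_complex.
Qed.

(** Conjugation negates [sin x], so the real and imaginary parts are exactly [cosB] and [sinB]. *)
Lemma cexpiB (R : realType) (x y : R) :
  cexp ('i * (y - x)%:C)%C = Num.conj (cexp ('i * x%:C)%C) * cexp ('i * y%:C)%C.
Proof.
rewrite !cexpi cosB sinB.
apply/eqP; rewrite eq_complex /=; apply/andP; split; apply/eqP.
  by rewrite mulNr opprK mulrC [sin y * _]mulrC.
by rewrite mulNr mulrC [cos y * _]mulrC.
Qed.

Lemma LamB (R : realType) (d : nat) (alpha : 'I_d -> R) (s t : int) :
  Lam alpha (t - s) = (Lam alpha s)^t* *m Lam alpha t.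
Proof.
rewrite /Lam tr_diag_mx map_diag_mx mulmx_diag; congr diag_mx.
apply/rowP => j; rewrite !mxE.
(* Moving the integer inside the embedding gives ['i] times a real, as [cexpiB] requires. *)
have E (k : int) : 'i%C * k%:~R * (alpha j)%:C%C = ('i * (k%:~R * alpha j)%:C)%C.
  by rewrite rmorphM rmorph_int mulrA.
by rewrite !E intrB mulrBl cexpiB.
Qed.

Theorem proposition3p3 (R : realType) (d : nat) (hd : (1 <= d)%N)
    (P : 'M[R[i]]_d) (hP : P \is unitarymx) (alpha : 'I_d -> R) (s t : int) :
  Wmx P alpha (t - s) = (Wmx P alpha s)^t* *m Wmx P alpha t.
Proof.
rewrite /Wmx LamB !trmx_mul !map_mxM trmxCK !mulmxA.
by rewrite mulmxtVK.
Qed.
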